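(* Let $\Lambda$ be a left hereditary ring. The stable category $\Lambda\text{-}\underline{\mathrm{Mod}}$ is normal if and only if the injective envelope of the left module ${}_{\Lambda}\Lambda$ is projective.
   Context: Rings are associative with identity; modules are left modules. The stable category $\Lambda\text{-}\underline{\mathrm{Mod}}$ has all left $\Lambda$-modules as objects; its morphisms are equivalence classes of $\Lambda$-homomorphisms, where $f$ and $g$ are equivalent if $f-g$ factors through a projective module. A monomorphism in a category is normal if it is a kernel of some morphism; a category is normal if every monomorphism in it is normal. *)

(* Defs.v *)
From HB Require Import structures.
From mathcomp Require Import all_boot all_algebra boolp.

Set Implicit Arguments.
Unset Strict Implicit.
Unset Printing Implicit Defensive.

Import GRing.Theory.
Local Open Scope ring_scope.
Local Open Scope quotient_scope.

(* Categories with zero morphisms.  The family [zero_mor] is determined by the *)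
(* underlying category, so that it is a property rather than extra data. *)
Record category := Category {
  Obj : Type;
  Hom : Obj -> Obj -> Type;
  idm : forall A, Hom A A;
  comp : forall A B C, Hom B C -> Hom A B -> Hom A C;
  zero_mor : forall A B, Hom A B;
  compA : forall A B C D (h : Hom C D) (g : Hom B C) (f : Hom A B),
    comp h (comp g f) = comp (comp h g) f;
  comp1m : forall A B (f : Hom A B), comp (idm B) f = f;
  compm1 : forall A B (f : Hom A B), comp f (idm A) = f;
  comp0m : forall A B C (f : Hom A B), comp (zero_mor B C) f = zero_mor A C;
  compm0 : forall A B C (f : Hom B C), comp f (zero_mor A B) = zero_mor A C
}.

Arguments Hom {c} A B.
Arguments idm {c} A.
Arguments comp {c A B C} g f.
Arguments zero_mor {c} A B.

Section CategoryNotions.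
Variable C : category.

Definition monomorphism (A B : Obj C) (f : Hom A B) : Prop :=
  forall (X : Obj C) (u v : Hom X A), comp f u = comp f v -> u = v.

Definition is_kernel (K A B : Obj C) (k : Hom K A) (g : Hom A B) : Prop :=
  comp g k = zero_mor K B /\
  forall (X : Obj C) (h : Hom X A), comp g h = zero_mor X B ->
    exists! u : Hom X K, comp k u = h.

Definition normal_mono (A B : Obj C) (f : Hom A B) : Prop :=
  exists (D : Obj C) (g : Hom B D), is_kernel f g.

End CategoryNotions.

Definition normal_category (C : category) : Prop :=
  forall (A B : Obj C) (f : Hom A B), monomorphism f -> normal_mono f.

(* The submodule S of V as a module in its own right. *)
Section Submodule.
Variables (R : pzRingType) (V : lmodType R) (S : submodClosed V).

Record submodule_type := SubmoduleElt {
  submodule_val :> V;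
  submodule_valP : submodule_val \in S
}.

HB.instance Definition _ := [isSub for submodule_val].
HB.instance Definition _ := [Choice of submodule_type by <:].
HB.instance Definition _ := [SubChoice_isSubLmodule of submodule_type by <:].

End Submodule.

Section Modules.
Variable R : pzRingType.

Definition projective (P : lmodType R) : Prop :=
  forall (M N : lmodType R) (g : {linear M -> N}) (f : {linear P -> N}),
    (forall y, exists x, g x = y) ->
    exists h : {linear P -> M}, forall x, g (h x) = f x.

Definition injective_module (Q : lmodType R) : Prop :=
  forall (M N : lmodType R) (g : {linear M -> N}) (f : {linear M -> Q}),
    injective g ->
    exists h : {linear N -> Q}, forall x, h (g x) = f x.

(* A left ideal of R is a submodule of the left regular module R^o. *)
Definition left_hereditary : Prop :=
  forall I : submodClosed R^o, projective (submodule_type I).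

Definition essential_mono (M E : lmodType R) (i : {linear M -> E}) : Prop :=
  injective i /\
  forall S : submodClosed E,
    (forall x, i x \in S -> i x = 0) -> forall y, y \in S -> y = 0.

Definition injective_envelope (M E : lmodType R) (i : {linear M -> E}) : Prop :=
  injective_module E /\ essential_mono i.

Definition factors_through_projective (M N : lmodType R) (h : M -> N) : Prop :=
  exists (P : lmodType R) (u : {linear M -> P}) (v : {linear P -> N}),
    projective P /\ forall x, h x = v (u x).

End Modules.

Section StableCategory.
Variable R : pzRingType.
Implicit Types M N L P : lmodType R.

Lemma projective_zero : projective 'rV[R]_0.
Proof.
move=> M N g f _; exists (\0 : {linear 'rV[R]_0 -> M}) => x.
by rewrite (_ : x = 0) ?raddf0 //; apply/rowP => -[].
Qed.

Lemma projective_prod P Q : projective P -> projective Q ->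
  projective (P * Q)%type.
Proof.
move=> hP hQ M N g f sg.
have inlL : linear (fun x : P => (x, 0) : (P * Q)%type).
  by move=> a x y; congr pair; rewrite /= scaler0 addr0.
have inrL : linear (fun y : Q => (0, y) : (P * Q)%type).
  by move=> a x y; congr pair; rewrite /= scaler0 addr0.
pose il : {linear P -> (P * Q)%type} :=
  HB.pack (fun x : P => (x, 0) : (P * Q)%type) (GRing.isLinear.Build _ _ _ _ _ inlL).
pose ir : {linear Q -> (P * Q)%type} :=
  HB.pack (fun y : Q => (0, y) : (P * Q)%type) (GRing.isLinear.Build _ _ _ _ _ inrL).
have [a ha] := hP M N g (f \o il) sg.
have [b hb] := hQ M N g (f \o ir) sg.
exists ((a \o fst) \+ (b \o snd)) => -[x y] /=.
rewrite raddfD; transitivity (f (il x) + f (ir y)).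
  by congr (_ + _); [exact: ha | exact: hb].
rewrite -raddfD; congr (f _); congr pair.
  exact: addr0.
exact: add0r.
Qed.

Lemma factors_ext M N (f g : M -> N) :
  f =1 g -> factors_through_projective f -> factors_through_projective g.
Proof.
by move=> e [P [u [v [hP h]]]]; exists P, u, v; split=> // x; rewrite -e.
Qed.

Lemma factors_zero M N : factors_through_projective (\0 : M -> N).
Proof.
by exists 'rV[R]_0, \0, \0; split; [exact: projective_zero|].
Qed.

Lemma factors_opp M N (f : M -> N) :
  factors_through_projective f -> factors_through_projective (\- f).
Proof.
move=> [P [u [v [hP h]]]]; exists P, u, (\- v); split=> // x /=.
by rewrite h.
Qed.

Lemma factors_add M N (f g : M -> N) :
  factors_through_projective f -> factors_through_projective g ->
  factors_through_projective (f \+ g).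
Proof.
move=> [P [u [v [hP h]]]] [Q [u' [v' [hQ h']]]].
have L : linear (fun x => (u x, u' x) : (P * Q)%type).
  by move=> a x y; congr pair; rewrite /= linearP.
pose w : {linear M -> (P * Q)%type} :=
  HB.pack (fun x => (u x, u' x) : (P * Q)%type)
    (GRing.isLinear.Build _ _ _ _ _ L).
exists (P * Q)%type, w, ((v \o fst) \+ (v' \o snd)).
by split; [exact: projective_prod | move=> x /=; rewrite h h'].
Qed.

Lemma factors_compl M N L (g : {linear N -> L}) (f : M -> N) :
  factors_through_projective f -> factors_through_projective (g \o f).
Proof.
by move=> [P [u [v [hP h]]]]; exists P, u, (g \o v); split=> // x /=; rewrite h.
Qed.

Lemma factors_compr M N L (g : N -> L) (f : {linear M -> N}) :
  factors_through_projective g -> factors_through_projective (g \o f).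
Proof.
by move=> [P [u [v [hP h]]]]; exists P, (u \o f), v; split=> // x /=; rewrite h.
Qed.

Definition stable_rel M N : rel {classic {linear M -> N}} :=
  fun f g : {linear M -> N} => `[< factors_through_projective (f \- g) >].

Lemma stable_rel_refl M N : reflexive (@stable_rel M N).
Proof.
move=> f; apply/asboolP; apply: factors_ext (factors_zero M N) => x /=.
by rewrite subrr.
Qed.

Lemma stable_rel_sym M N : symmetric (@stable_rel M N).
Proof.
have H f g : @stable_rel M N f g -> stable_rel g f.
  move=> /asboolP h; apply/asboolP; apply: factors_ext (factors_opp h) => x /=.
  by rewrite opprB.
by move=> f g; apply/idP/idP; exact: H.
Qed.

Lemma stable_rel_trans M N : transitive (@stable_rel M N).
Proof.
move=> g f h /asboolP p /asboolP q; apply/asboolP.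
by apply: factors_ext (factors_add p q) => x /=; rewrite subrKA.
Qed.

Canonical stable_equiv M N := EquivRel (@stable_rel M N)
  (@stable_rel_refl M N) (@stable_rel_sym M N) (@stable_rel_trans M N).

Definition stable_hom M N : Type := {eq_quot @stable_rel M N}.

Definition stable_class M N (f : {linear M -> N}) : stable_hom M N :=
  \pi_({eq_quot @stable_rel M N}) (f : {classic {linear M -> N}}).

Definition stable_repr M N (f : stable_hom M N) : {linear M -> N} :=
  repr (f : {eq_quot @stable_rel M N}).

Definition stable_id M : stable_hom M M := stable_class idfun.

Definition stable_zero M N : stable_hom M N := stable_class \0.

Definition stable_comp M N L (g : stable_hom N L) (f : stable_hom M N) :
  stable_hom M L := stable_class (stable_repr g \o stable_repr f).

Lemma stable_classP M N (f g : {linear M -> N}) :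
  stable_class f = stable_class g <-> factors_through_projective (f \- g).
Proof.
split; first by move/eqmodP/asboolP.
by move=> h; apply/eqmodP/asboolP.
Qed.

Lemma stable_reprK M N (f : stable_hom M N) : stable_class (stable_repr f) = f.
Proof. exact: reprK. Qed.

Lemma stable_comp_class M N L (g : {linear N -> L}) (f : {linear M -> N}) :
  stable_comp (stable_class g) (stable_class f) = stable_class (g \o f).
Proof.
apply/stable_classP.
set g' := stable_repr _; set f' := stable_repr _.
have /stable_classP hg : stable_class g' = stable_class g by exact: stable_reprK.
have /stable_classP hf : stable_class f' = stable_class f by exact: stable_reprK.
apply: factors_ext (factors_add (factors_compl g' hf) (factors_compr f hg)).
by move=> x /=; rewrite raddfB subrKA.
Qed.

Lemma stable_class_ext M N (f g : {linear M -> N}) :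
  f =1 g -> stable_class f = stable_class g.
Proof.
move=> e; apply/stable_classP; apply: factors_ext (factors_zero M N) => x /=.
by rewrite e subrr.
Qed.

Lemma stable_compA M N L K (h : stable_hom L K) (g : stable_hom N L)
    (f : stable_hom M N) :
  stable_comp h (stable_comp g f) = stable_comp (stable_comp h g) f.
Proof.
rewrite -(stable_reprK h) -(stable_reprK g) -(stable_reprK f).
by rewrite !stable_comp_class; exact: stable_class_ext.
Qed.

Lemma stable_comp1m M N (f : stable_hom M N) : stable_comp (stable_id N) f = f.
Proof.
by rewrite -(stable_reprK f) stable_comp_class; exact: stable_class_ext.
Qed.

Lemma stable_compm1 M N (f : stable_hom M N) : stable_comp f (stable_id M) = f.
Proof.
by rewrite -(stable_reprK f) stable_comp_class; exact: stable_class_ext.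
Qed.

Lemma stable_comp0m M N L (f : stable_hom M N) :
  stable_comp (stable_zero N L) f = stable_zero M L.
Proof.
by rewrite -(stable_reprK f) stable_comp_class; exact: stable_class_ext.
Qed.

Lemma stable_compm0 M N L (f : stable_hom N L) :
  stable_comp f (stable_zero M N) = stable_zero M L.
Proof.
rewrite -(stable_reprK f) stable_comp_class; apply: stable_class_ext => x /=.
exact: raddf0.
Qed.

Definition stable_category : category :=
  Category stable_compA stable_comp1m stable_compm1 stable_comp0m stable_compm0.

End StableCategory.

(* Main.v *)
(* Over a left hereditary ring, submodules of projectives are projective and
   quotients of injectives are injective, so a stable map is mono exactly when
   its kernel is projective.

   If the category is normal, the stable mono p : E(R) -> E(R)/R is a stable
   kernel of some g.  Then Ker g -> E(R)/R lifts stably along p, and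
   essentiality of R in E(R) forces Ker g to be projective, whence so is E(R).

   Conversely let E = E(R) be projective.  Then every direct sum of copies of E
   is injective: by Baer's criterion this reduces to showing that E contains no
   infinite family of independent vectors v_b, indexed by b in nat * nat.  For
   a set A of indices let F A be the closure of {v_b : b in A} in E, which is a
   direct summand of E.  The union J of the F A over all A with finite columns
   is projective, and it is countably generated because it is essential over
   the span of the v_b; but the ideal of sets with finite columns is not
   countably generated, by a diagonal argument.  Hence every projective embeds
   in a projective injective module, and a stable mono f : M -> N becomes, after
   adding such a module to N, an honest monomorphism, the kernel of its
   cokernel. *)
From HB Require Import structures.
Require Import Defs.
From mathcomp Require Import all_boot all_algebra.
From mathcomp Require Import finmap boolp classical_sets functions cardinality fsbigop.

Set Implicit Arguments.
Unset Strict Implicit.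
Unset Printing Implicit Defensive.

Import GRing.Theory Num.Theory.
Local Open Scope classical_set_scope.
Local Open Scope ring_scope.

(** * Submodules and quotient modules *)

Definition linear_of (R : pzRingType) (M N : lmodType R) (f : M -> N)
    (fL : linear f) : {linear M -> N} :=
  HB.pack f (GRing.isLinear.Build _ _ _ _ _ fL).

Section QuotientModule.
Variables (R : pzRingType) (V : lmodType R) (S : submodClosed V).

Fact submodClosed_zmod_closed : zmod_closed (fun x => x \in S).
Proof.
by split=> [|x y xS yS]; rewrite ?rpred0 // -scaleN1r rpredD // rpredZ.
Qed.

Definition submod_zmodClosed : zmodClosed V :=
  HB.pack (fun x => x \in S) (GRing.isZmodClosed.Build V _ submodClosed_zmod_closed).

Definition quotient_module : Type := Quotient.quot submod_zmodClosed.

HB.instance Definition _ := GRing.Zmodule.on quotient_module.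

Definition quotient_proj (x : V) : quotient_module :=
  \pi_(Quotient.quot submod_zmodClosed)%qT x.

Lemma quotient_proj_surj y : exists x, quotient_proj x = y.
Proof. by exists (repr y); exact: reprK. Qed.

Lemma quotient_projE x y : quotient_proj x = quotient_proj y <-> x - y \in S.
Proof.
have := Quotient.idealrBE submod_zmodClosed x y.
rewrite -[x - y \in submod_zmodClosed]/(x - y \in S) => ->.
by split=> /eqP.
Qed.

(** [Quotient.quot] divides by an additive subgroup; the scalar action is added afterwards, through
    representatives. *)
Definition quotient_scale (a : R) (y : quotient_module) : quotient_module :=
  quotient_proj (a *: repr y).

Lemma quotient_proj_scale a x :
  quotient_proj (a *: x) = quotient_scale a (quotient_proj x).
Proof.
apply/quotient_projE; rewrite -scalerBr; apply: rpredZ.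
by apply/quotient_projE; rewrite /quotient_proj reprK.
Qed.

Let projD x y : quotient_proj (x + y) = quotient_proj x + quotient_proj y.
Proof. exact: (raddfD (\pi_(Quotient.quot submod_zmodClosed))%qT). Qed.

Fact quotient_scalerA a b y :
  quotient_scale a (quotient_scale b y) = quotient_scale (a * b) y.
Proof.
by have [x <-] := quotient_proj_surj y; rewrite -!quotient_proj_scale scalerA.
Qed.

Fact quotient_scale1r : left_id 1 quotient_scale.
Proof.
by move=> y; have [x <-] := quotient_proj_surj y;
  rewrite -quotient_proj_scale scale1r.
Qed.

Fact quotient_scalerDr : right_distributive quotient_scale +%R.
Proof.
move=> a y z; have [x <-] := quotient_proj_surj y.
have [x' <-] := quotient_proj_surj z.
by rewrite -projD -!quotient_proj_scale -projD scalerDr.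
Qed.

Fact quotient_scalerDl y : {morph quotient_scale^~ y: a b / a + b}.
Proof.
move=> a b; have [x <-] := quotient_proj_surj y.
by rewrite -!quotient_proj_scale -projD scalerDl.
Qed.

HB.instance Definition _ := GRing.Zmodule_isLmodule.Build R quotient_module
  quotient_scalerA quotient_scale1r quotient_scalerDr quotient_scalerDl.

Lemma quotient_proj_linear : linear quotient_proj.
Proof. by move=> a x y; rewrite projD quotient_proj_scale. Qed.

End QuotientModule.

Section Modules.
Variable R : pzRingType.
Implicit Types K M N L P Q V : lmodType R.

(** Submodules as plain sets, so that unions of chains, images and preimages are directly available;
    [submodClosed_exists] converts back. *)
Definition is_submodule V (A : set V) :=
  A 0 /\ forall a x y, A x -> A y -> A (a *: x + y).

Section SubmoduleTheory.
Variables (V : lmodType R) (A : set V).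
Hypothesis hA : is_submodule A.

Lemma submodule0 : A 0. Proof. by case: hA. Qed.

Lemma submoduleD x y : A x -> A y -> A (x + y).
Proof. by move=> Ax Ay; rewrite -[x]scale1r; apply: hA.2. Qed.

Lemma submoduleZ a x : A x -> A (a *: x).
Proof. by move=> Ax; rewrite -[_ *: _]addr0; apply: hA.2 => //; exact: hA.1. Qed.

Lemma submoduleN x : A x -> A (- x).
Proof. by rewrite -scaleN1r; exact: submoduleZ. Qed.

Lemma submoduleB x y : A x -> A y -> A (x - y).
Proof. by move=> Ax /submoduleN; exact: submoduleD. Qed.

Lemma submodClosed_exists : exists S : submodClosed V, forall x, x \in S <-> A x.
Proof.
have H : subsemimod_closed (fun x => `[< A x >]).
  split; first split; first by apply/asboolP/submodule0.
    by move=> x y /asboolP Ax /asboolP Ay; apply/asboolP/submoduleD.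
  by move=> a x /asboolP Ax; apply/asboolP/submoduleZ.
pose S : submodClosed V :=
  HB.pack (fun x => `[< A x >]) (GRing.isSubmodClosed.Build R V _ H).
by exists S => x; split=> [/asboolP|h]; last exact/asboolP.
Qed.

Lemma quotient_exists : exists (Q : lmodType R) (p : {linear V -> Q}),
  (forall y, exists x, p x = y) /\ forall x, p x = 0 <-> A x.
Proof.
have [S hS] := submodClosed_exists.
exists (quotient_module S), (linear_of (@quotient_proj_linear R V S)).
split; first exact: quotient_proj_surj.
move=> x; rewrite -hS -{2}[x]subr0 -quotient_projE.
rewrite (_ : quotient_proj S 0 = 0) //.
exact: (raddf0 (linear_of (@quotient_proj_linear R V S))).
Qed.

Lemma submodule_exists : exists (K : lmodType R) (k : {linear K -> V}),
  injective k /\ forall x, A x <-> exists y, k y = x.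
Proof.
have [S hS] := submodClosed_exists.
exists (submodule_type S), \val; split; first exact: val_inj.
move=> x; rewrite -hS; split=> [xS|[y <-]]; last exact: valP.
by exists (SubmoduleElt xS).
Qed.

End SubmoduleTheory.

Lemma submodClosed_is_submodule V (S : submodClosed V) :
  is_submodule [set x | x \in S].
Proof.
split; first exact: rpred0.
by move=> a x y xS yS /=; apply: rpredD => //; exact: rpredZ.
Qed.

Lemma preimage_is_submodule M N (f : {linear M -> N}) (A : set N) :
  is_submodule A -> is_submodule (f @^-1` A).
Proof.
move=> hA; split=> /=; first by rewrite raddf0; exact: submodule0.
by move=> a x y; rewrite linearP; exact: hA.2.
Qed.

Lemma image_is_submodule M N (f : {linear M -> N}) (A : set M) :
  is_submodule A -> is_submodule (f @` A).
Proof.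
move=> hA; split=> /=; first by exists 0; [exact: submodule0|exact: raddf0].
move=> a _ _ [x Ax <-] [y Ay <-]; exists (a *: x + y); last exact: linearP.
exact: hA.2.
Qed.

Lemma zero_is_submodule V : is_submodule [set 0 : V].
Proof. by split=> // a x y /= -> ->; rewrite scaler0 addr0. Qed.

Lemma setT_is_submodule V : is_submodule [set: V].
Proof. by []. Qed.

Definition addS V (A B : set V) : set V :=
  [set z | exists x y, [/\ A x, B y & z = x + y]].

Lemma addS_is_submodule V (A B : set V) :
  is_submodule A -> is_submodule B -> is_submodule (addS A B).
Proof.
move=> hA hB; split.
  by exists 0, 0; split; rewrite ?addr0 //; exact: submodule0.
move=> a _ _ [x [y [Ax By ->]]] [x' [y' [Ax' By' ->]]].
exists (a *: x + x'), (a *: y + y'); split; [exact: hA.2|exact: hB.2|].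
by rewrite scalerDr addrACA.
Qed.

Lemma linear_inj M N (f : {linear M -> N}) :
  (forall x, f x = 0 -> x = 0) -> injective f.
Proof. by move=> h x y e; apply/subr0_eq/h; rewrite linearB e subrr. Qed.

Lemma linear_inj0 M N (f : {linear M -> N}) x : injective f -> f x = 0 -> x = 0.
Proof. by move=> h e; apply: h; rewrite e raddf0. Qed.

Lemma lift_through_inj K V M (k : {linear K -> V}) (f : {linear M -> V}) :
  injective k -> (forall x, exists y, k y = f x) ->
  exists f' : {linear M -> K}, forall x, k (f' x) = f x.
Proof.
move=> kI /choice[f' f'E].
have L : linear f' by move=> a x y; apply: kI; rewrite linearP !f'E linearP.
by exists (linear_of L).
Qed.

Lemma factor_surj V Q N (p : {linear V -> Q}) (f : {linear V -> N}) :
  (forall y, exists x, p x = y) -> (forall x, p x = 0 -> f x = 0) ->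
  exists f' : {linear Q -> N}, forall x, f' (p x) = f x.
Proof.
move=> /choice[s sE] h.
have E x : f (s (p x)) = f x.
  by apply/subr0_eq; rewrite -linearB; apply: h; rewrite linearB sE subrr.
have L : linear (f \o s).
  move=> a x y /=; rewrite -(linearP f) -[RHS]E; congr (f (s _)).
  by rewrite linearP !sE.
by exists (linear_of L).
Qed.

Lemma pair_linear M N L (f : {linear M -> N}) (g : {linear M -> L}) :
  linear (fun x => (f x, g x) : (N * L)%type).
Proof. by move=> a x y; congr pair; rewrite /= linearP. Qed.

End Modules.

(** * Direct sums *)

Section DirectSum.
Variables (R : pzRingType) (X : choiceType) (V : lmodType R).
Implicit Types M Q : lmodType R.

Definition finsupp (q : X -> V) : set X := [set x | q x <> 0].

Fact finsupp_is_submodule : is_submodule [set q : X -> V | finite_set (finsupp q)].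
Proof.
split=> [|a q q' hq hq'] /=.
  by apply: (sub_finite_set _ (finite_set0 X)) => x; case.
apply: (@sub_finite_set _ _ (finsupp q `|` finsupp q')).
  move=> x /=; apply: contra_notP => /not_orP[/contrapT e /contrapT e'].
  by rewrite /GRing.add/= /GRing.scale/= e e' scaler0 addr0.
by rewrite finite_setU.
Qed.

(** The direct sum is realised by finitely supported functions, with coordinates [c] and inclusions
    [i]. Maps out of it are determined freely on the summands; a family of maps into the summands
    assembles only if it is pointwise finite. *)
Lemma direct_sum_exists : exists (Q : lmodType R)
    (c : X -> {linear Q -> V}) (i : X -> {linear V -> Q}),
  [/\ forall q, finite_set [set x | c x q <> 0],
      forall q q', (forall x, c x q = c x q') -> q = q',
      forall x y v, c x (i y v) = if x == y then v else 0,
      forall (A : set Q) q, is_submodule A ->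
        (forall x, A (i x (c x q))) -> A q
    & forall M (f : X -> {linear M -> V}),
        (forall m, finite_set [set x | f x m <> 0]) ->
        exists g : {linear M -> Q}, forall x m, c x (g m) = f x m] /\
    (forall M (h : X -> {linear V -> M}),
        exists g : {linear Q -> M}, forall x v, g (i x v) = h x v).
Proof.
have [Q [k [kI kE]]] := submodule_exists finsupp_is_submodule.
have fin q : finite_set (finsupp (k q)) by apply/kE; exists q.
have cL x : linear (fun q => k q x) by move=> a q q'; rewrite linearP.
pose c x : {linear Q -> V} := linear_of (cL x).
have cI q q' : (forall x, c x q = c x q') -> q = q'.
  by move=> h; apply: kI; apply/funext => x; exact: h.
have lift M (f : X -> {linear M -> V}) :
    (forall m, finite_set [set x | f x m <> 0]) ->
    exists g : {linear M -> Q}, forall x m, c x (g m) = f x m.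
  move=> ffin.
  have fL : linear (fun m => f ^~ m : X -> V).
    by move=> a m m'; apply/funext => x; rewrite linearP.
  have [m|g gE] := lift_through_inj (f := linear_of fL) kI.
    by apply/kE; exact: ffin.
  by exists g => x m; rewrite /c /= gE.
have unitL (y x : X) : linear (fun v : V => if x == y then v else 0).
  by move=> a v w; case: ifP => // _; rewrite scaler0 addr0.
have unit_exists y : exists g : {linear V -> Q},
    forall x v, c x (g v) = if x == y then v else 0.
  have [|g gE] := lift V (fun x => linear_of (unitL y x)).
    move=> v; apply: (sub_finite_set _ (finite_set1 y)) => x /=.
    by apply: contra_notP => /eqP /negbTE ->.
  by exists g.
have [i iE] := choice unit_exists.
have sumE M (h : X -> {linear V -> M}) q (D : set X) : finite_set D ->
    finsupp (k q) `<=` D ->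
    \sum_(x \in [set: X]) h x (c x q) = \sum_(x <- fset_set D) h x (c x q).
  move=> Dfin sD; apply: fsbigTE => x; rewrite in_fset_set // => xD.
  rewrite (_ : c x q = 0) ?linear0 //; apply: contrapT => /sD.
  by move/mem_set; rewrite (negbTE xD).
have sumL M (h : X -> {linear V -> M}) :
    linear (fun q => \sum_(x \in [set: X]) h x (c x q)).
  move=> a q q'.
  (* Over one finite set containing all three supports, the sums become ordinary sums and linearity
     is termwise. *)
  pose D := finsupp (k q) `|` finsupp (k q') `|` finsupp (k (a *: q + q')).
  have Dfin : finite_set D by rewrite !finite_setU.
  have [s1 s2] : finsupp (k q) `<=` D /\ finsupp (k q') `<=` D.
    by split=> x; rewrite /D; [left; left|left; right].
  have s3 : finsupp (k (a *: q + q')) `<=` D by move=> x; right.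
  rewrite (sumE _ _ _ _ Dfin s1) (sumE _ _ _ _ Dfin s2) (sumE _ _ _ _ Dfin s3).
  rewrite scaler_sumr -big_split /=; apply: eq_bigr => x _.
  by rewrite !linearP.
have unitS M (g : X -> {linear V -> M}) y v :
    \sum_(x \in [set: X]) g x (c x (i y v)) = g y v.
  rewrite (sumE _ _ _ [set y]) //; last first.
    move=> x xs; apply: contrapT => /eqP/negbTE e; apply: xs.
    by have := iE y x v; rewrite e.
  rewrite fset_set1 big_seq_fset1; transitivity (g y (c y (i y v))) => //.
  by rewrite iE eqxx.
have sumK q : q = \sum_(x <- fset_set (finsupp (k q))) i x (c x q).
  apply: cI => y; rewrite linear_sum; set D := fset_set _.
  transitivity (\sum_(x <- D) if y == x then c x q else 0); last first.
    by apply: eq_bigr => x _; rewrite iE.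
  rewrite -big_mkcond /=.
  have [e|/contrapT e] := pselect (finsupp (k q) y).
    rewrite (big_rem y) ?in_fset_set ?inE //= eqxx big1_seq ?addr0 //.
    by move=> x /andP[/eqP <-]; rewrite mem_rem_uniq ?fset_uniq // inE /= eqxx.
  by rewrite /c /= e big1 // => x /eqP <-; exact: e.
exists Q, c, i; split.
  split=> // A q hA Aq; rewrite [q]sumK.
  by elim/big_ind: _ => // [|x y]; [exact: submodule0|exact: submoduleD].
by move=> M h; exists (linear_of (sumL M h)) => x v; exact: unitS.
Qed.

End DirectSum.

(** * Maximal submodules and Baer's criterion *)

Section Zorn.
Variable R : pzRingType.
Implicit Types K M N L P Q V : lmodType R.

Lemma maximal_submodule V (p A0 : set V) : is_submodule A0 -> A0 `<=` p ->
  exists A : set V, [/\ is_submodule A, A0 `<=` A, A `<=` p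
    & forall B, is_submodule B -> A `<=` B -> B `<=` p -> B `<=` A].
Proof.
move=> hA0 A0p.
pose good (A : set V) := [/\ is_submodule A, A0 `<=` A & A `<=` p].
have [F FP Ftot|A [AP Amax]] := @Zorn_bigcup V [set A | A = set0 \/ good A].
  have [FE|] := pselect (forall X, F X -> X = set0).
    by left; apply/seteqP; split=> // x [X /FE->].
  move=> /existsNP[X0 /not_implyP[FX0 X0n0]]; right.
  have [//|[hX0 A0X0 _]] := FP _ FX0.
  split.
  - split; first by exists X0 => //; exact: submodule0.
    move=> a x y [X FX Xx] [Y FY Yy].
    have [XY|YX] := Ftot _ _ FX FY.
      exists Y => //; have [Y0|[hY _ _]] := FP _ FY; first by move: Yy; rewrite Y0.
      by apply: hY.2 => //; exact: XY.
    exists X => //; have [X_0|[hX _ _]] := FP _ FX; first by move: Xx; rewrite X_0.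
    by apply: hX.2 => //; exact: YX.
  - by move=> x /A0X0 X0x; exists X0.
  - by move=> x [X FX Xx]; have [X_0|[_ _]] := FP _ FX; [move: Xx; rewrite X_0|exact].
have {AP}[A_0|[hA A0A Ap]] := AP.
  have : A `<` A0.
    by rewrite A_0; split=> // A0_0; exact: (A0_0 0 (submodule0 hA0)).
  by move=> /Amax []; right; split.
exists A; split=> // B hB AB Bp; apply: contrapT => nBA.
by apply: (Amax B); [split|right; split=> // x /A0A/AB].
Qed.

Definition essential V (A : set V) := forall D : set V, is_submodule D ->
  (forall x, D x -> A x -> x = 0) -> forall x, D x -> x = 0.

Lemma maximal_complement V (A : set V) : is_submodule A ->
  exists C : set V, [/\ is_submodule C, forall x, A x -> C x -> x = 0
    & forall D, is_submodule D -> C `<=` D ->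
        (forall x, A x -> D x -> x = 0) -> D `<=` C].
Proof.
move=> hA.
have [|x -> //|C [hC _ Cp Cmax]] := @maximal_submodule V
  [set x | A x -> x = 0] [set 0]; first exact: zero_is_submodule.
exists C; split=> // [x Ax Cx|D hD CD Dp]; first exact: Cp.
by apply: Cmax => // x Dx Ax; exact: Dp.
Qed.

(** With C maximal, if D meets A + C trivially then C + D still meets A trivially, so D lies in C
    and vanishes. *)
Lemma complement_essential V (A : set V) : is_submodule A ->
  exists C : set V, [/\ is_submodule C, forall x, A x -> C x -> x = 0
    & essential (addS A C)].
Proof.
move=> hA; have [C [hC AC Cmax]] := maximal_complement hA.
exists C; split=> // D hD DAC x Dx; apply: (DAC) => //.
exists 0, x; split; [exact: submodule0| |by rewrite add0r].
apply: (Cmax (addS C D)); first exact: addS_is_submodule.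
- by move=> y Cy; exists y, 0; split; rewrite ?addr0 //; exact: submodule0.
- move=> y Ay [c [d [Cc Dd ye]]]; rewrite ye in Ay *.
  have d0 : d = 0.
    apply: DAC => //; exists (c + d), (- c); split=> //; first exact: submoduleN.
    by rewrite addrC addKr.
  by move: Ay; rewrite d0 addr0 => Ac; exact: AC.
- by exists 0, x; split; rewrite ?add0r //; exact: submodule0.
Qed.

Definition baer Q := forall K (k : {linear K -> R^o}) (f : {linear K -> Q}),
  injective k -> exists q, forall x, f x = (k x : R) *: q.

(** Partial extensions of f are encoded by their graphs, the submodules of N * Q in which a zero
    first component forces a zero second one. A maximal graph is total: for n outside its domain,
    the hypothesis on the ideal of all r with r n in the domain yields a value for n. *)
Lemma baer_injective Q : baer Q -> injective_module Q.
Proof.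
move=> bQ M N g f gI.
pose Gr := [set u : (N * Q)%type | exists x, u = (g x, f x)].
have hGr : is_submodule Gr.
  split; first by exists 0; congr pair; rewrite linear0.
  move=> a _ _ [x ->] [y ->]; exists (a *: x + y).
  by congr pair; rewrite /= linearP.
have [u [x ->] /= gx0|G [hG GrG Gp Gmax]] :=
  @maximal_submodule _ [set u : (N * Q)%type | u.1 = 0 -> u.2 = 0] Gr hGr.
  by rewrite (linear_inj0 gI gx0) linear0.
have Guniq n q q' : G (n, q) -> G (n, q') -> q = q'.
  move=> Gq Gq'; apply/subr0_eq.
  exact: (Gp _ (submoduleB hG Gq Gq') (subrr n)).
have total n : exists q, G (n, q).
  pose I := [set r : R^o | exists q, G ((r : R) *: n, q)].
  have hI : is_submodule I.
    split; first by exists 0; rewrite scale0r; exact: (submodule0 hG).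
    move=> a r s [q Gq] [q' Gq']; exists (a *: q + q').
    have := hG.2 a _ _ Gq Gq'; congr G; congr pair; rewrite /=.
    by rewrite scalerDl scalerA.
  have [K [k [kI kE]]] := submodule_exists hI.
  have /choice[t tE] : forall x : K, exists q, G ((k x : R) *: n, q).
    by move=> x; apply/kE; exists x.
  have tL : linear t.
    move=> a x y; apply: (Guniq ((k (a *: x + y) : R) *: n)) => //.
    have := hG.2 a _ _ (tE x) (tE y); congr G; congr pair; rewrite /=.
    by rewrite linearP scalerDl scalerA.
  have [q0 q0E] := bQ K k (linear_of tL) kI.
  exists q0.
  pose B := addS G [set u : (N * Q)%type | exists r : R, u = (r *: n, r *: q0)].
  apply: (Gmax B).
  - apply: addS_is_submodule => //; split; first by exists 0; rewrite !scale0r.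
    move=> a _ _ [r ->] [s ->]; exists (a * r + s).
    by congr pair; rewrite /= scalerDl scalerA.
  - move=> u Gu; exists u, 0; split; rewrite ?addr0 //.
    by exists 0; rewrite !scale0r.
  (* If m + r n = 0, then r n has the value -q in the graph; as r lies in [I], its value is also r
     q0, whence q + r q0 = 0. *)
  - move=> _ [[m q] [_ [Gmq [r ->] ->]]] /= e.
    have Gr' : G (r *: n, - q).
      have := submoduleN hG Gmq; congr G; congr pair.
      by apply/eqP; rewrite eq_sym -addr_eq0 addrC; apply/eqP.
    have /kE[x xE] : I r by exists (- q).
    have := q0E x; rewrite /= xE => tx.
    have Gt := tE x; rewrite xE in Gt.
    by rewrite -tx -(Guniq _ _ _ Gr' Gt) subrr.
  - exists 0, (n, q0); split; [exact: submodule0| |by rewrite add0r].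
    by exists 1; rewrite !scale1r.
have /choice[h hE] := total.
have hL : linear h.
  move=> a x y; apply: (Guniq (a *: x + y)) => //.
  exact: (hG.2 a _ _ (hE x) (hE y)).
by exists (linear_of hL) => x; apply: (Guniq (g x)) => //; apply: GrG; exists x.
Qed.

(** The projection of the direct sum of A and C onto A extends to Q, though its values outside A + C
    need not lie in A. *)
Lemma injective_projection Q (A C : set Q) : injective_module Q ->
  is_submodule A -> is_submodule C -> (forall x, A x -> C x -> x = 0) ->
  exists e : {linear Q -> Q},
    (forall x, A x -> e x = x) /\ (forall x, C x -> e x = 0).
Proof.
move=> hQ hA hC AC.
have [K [k [kI kE]]] := submodule_exists hA.
have [L [l [lI lE]]] := submodule_exists hC.
pose g : {linear (K * L)%type -> Q} := (k \o fst) \+ (l \o snd).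
have gI : injective g.
  apply: linear_inj => -[x y] /= /eqP; rewrite addr_eq0 => /eqP e.
  have kx0 : k x = 0.
    apply: AC; first by apply/kE; exists x.
    by rewrite e; apply: submoduleN => //; apply/lE; exists y.
  have x0 := linear_inj0 kI kx0.
  have y0 : y = 0.
    by apply: (linear_inj0 lI); apply/eqP; rewrite -oppr_eq0 -e kx0.
  by rewrite x0 y0.
have [e eE] := hQ _ _ g (k \o fst) gI.
exists e; split.
  move=> _ /kE[x <-]; have := eE (x, 0); rewrite /= linear0 addr0.
  exact.
move=> _ /lE[y <-]; have := eE (0, y); rewrite /= !linear0 add0r.
exact.
Qed.

End Zorn.

(** * Enough injectives *)

Section RationalsModIntegers.

Lemma int_submodule_principal (I : set (int : pzRingType)^o) :
  is_submodule I -> exists d : int, forall n, I n <-> exists m : int, n = m * d.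
Proof.
move=> hI; have [I0|] := pselect (forall n, I n -> n = 0).
  exists 0 => n; split=> [/I0 ->|[m ->]]; first by exists 0; rewrite mulr0.
  by rewrite mulr0; exact: (submodule0 hI).
move=> /existsNP[n0 /not_implyP[In0 n0n0]].
pose P k := `[< exists n : int, [/\ I n, n != 0 & `|n|%N = k] >].
have exP : exists k, P k.
  by exists `|n0|%N; apply/asboolP; exists n0; split=> //; exact/eqP.
case: (ex_minnP exP) => _ /asboolP[d [Id d0 <-]] dmin.
exists d => n; split=> [In|[m ->]]; last exact: (submoduleZ hI).
exists (n %/ d)%Z; apply: contrapT => /eqP; rewrite -subr_eq0 => nz.
have Ir : I (n - (n %/ d)%Z * d).
  by apply: (submoduleB hI) => //; exact: (submoduleZ hI).
have rE : n - (n %/ d)%Z * d = (n %% d)%Z.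
  by rewrite {1}(divz_eq n d) addrAC subrr add0r.
rewrite rE in nz Ir.
have /dmin : P `|(n %% d)%Z|%N by apply/asboolP; exists (n %% d)%Z.
rewrite leqNgt => /negP; apply.
by rewrite -ltz_nat !abszE ger0_norm ?modz_ge0 // ltz_mod.
Qed.

Lemma intZE (T : lmodType int) (n : int) (t : T) : n *: t = t *~ n.
Proof. by rewrite -{1}[n]intz scaler_int. Qed.

Lemma zmod_morphism_intL (M : zmodType) (T : lmodType int) (f : M -> T) :
  zmod_morphism f -> linear (f : zmodule M -> T).
Proof.
move=> fB a x y.
pose g : {additive M -> T} := HB.pack f (GRing.isZmodMorphism.Build M T f fB).
rewrite (intZE a (f x)) -[RHS]/((g x *~ a) + g y) -raddfMz -raddfD.
by congr (f _).
Qed.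

Lemma mulrz_divK (w : rat) (m d : int) :
  d != 0 -> w *~ m = (w / d%:~R) *~ (m * d).
Proof.
move=> d0; rewrite -[w *~ m]mulrzl -[_ *~ (m * d)]mulrzl rmorphM /=.
by rewrite -mulrA (mulrC w) mulVKf ?intr_eq0.
Qed.

Lemma mulrz_intM (w : rat) (k m d : int) :
  w *~ d = k%:~R -> w *~ (m * d) = (k * m)%:~R.
Proof. by move=> e; rewrite (mulrC m) [LHS]mulrzA e rmorphM /= mulrzr. Qed.

Lemma invr_int_eq (d n : int) : d != 0 -> d%:~R^-1 = n%:~R :> rat -> d * n = 1.
Proof.
move=> d0 e; apply: (@intr_inj rat).
by rewrite rmorphM /= -e mulfV ?intr_eq0.
Qed.

(** A map sending the generator d of an ideal to the class of w extends by sending 1 to the class of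
    w / d. A nonzero x is detected on the cyclic group it generates, and injectivity extends the map
    found there. *)
Lemma int_injective_cogenerator : exists T : lmodType int, injective_module T /\
  forall (M : lmodType int) (x : M), x <> 0 ->
    exists f : {linear M -> T}, f x <> 0.
Proof.
have hZ : is_submodule [set q : zmodule rat | exists n : int, q = n%:~R].
  split; first by exists 0.
  move=> a _ _ [n ->] [m ->]; exists (a * n + m).
  by rewrite -[a *: _]/(_ *~ a) rmorphD rmorphM /= mulrzl.
have [T [p [psurj pE]]] := quotient_exists hZ.
have Tinj : injective_module T.
  apply: baer_injective => K k f kI.
  have [d dE] := int_submodule_principal (image_is_submodule k (@setT_is_submodule _ K)).
  have [x _ kx] : (k @` setT) d by apply/dE; exists 1; rewrite mul1r.
  have [w we] := psurj (f x).
  exists (p (w / d%:~R)) => y.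
  have [m ky] : exists m : int, k y = m * d by apply/dE; exists y.
  have [d0|d0] := eqVneq d 0.
    by rewrite (linear_inj0 (x := y) kI) ?ky ?d0 ?mulr0 // !linear0 scale0r.
  have yE : y = m *: x by apply: kI; rewrite ky linearZ kx.
  have -> : f y = p (m *: w) by rewrite linearZ we yE linearZ.
  rewrite ky -linearZ; congr (p _); rewrite !scalezrE.
  exact: mulrz_divK.
exists T; split=> // M x x0.
have nxL : linear (fun n : (int : pzRingType)^o => (n : int) *: x).
  by move=> a m n; rewrite scalerDl scalerA.
pose nx := linear_of nxL.
have hI := preimage_is_submodule nx (@zero_is_submodule _ M).
have [d dE] := int_submodule_principal hI.
(* Take w = 1 / d, which is not an integer because d would then be a unit and x would vanish; when x
   has infinite order, so that d = 0, take w = 1 / 2. *)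
have [w [wd wZ]] : exists w : rat, (exists n : int, w *~ d = n%:~R) /\ forall n : int, w <> n%:~R.
  have [d0|d0] := eqVneq d 0.
    exists 2%:~R^-1; split; first by exists 0; rewrite d0.
    move=> n /(invr_int_eq (isT : (2 : int) != 0)) /(congr1 absz).
    by rewrite abszM => /(congr1 odd); rewrite oddM.
  exists d%:~R^-1; split.
    by exists 1; rewrite -mulrzl mulfV ?intr_eq0.
  move=> n /(invr_int_eq d0) dn.
  apply: x0; have : nx 1 = 0 by apply/dE; exists n; rewrite mulrC.
  by rewrite /= scale1r.
have psiL : linear (fun n : (int : pzRingType)^o => p (w *~ n)).
  move=> a m n; rewrite -linearP; congr (p _).
  by rewrite mulrzDr scalezrE -mulrzA mulrC.
have [Q [q [qsurj qE]]] := quotient_exists hI.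
have [g gE] := factor_surj (f := nx) qsurj (fun n => proj1 (qE n)).
have [f fE] : exists f : {linear Q -> T}, forall n, f (q n) = p (w *~ n).
  apply: (factor_surj (f := linear_of psiL) qsurj) => n /qE /dE[m ->].
  apply/pE; have [k kE] := wd; exists (k * m).
  exact: mulrz_intM.
have gI : injective g.
  apply: linear_inj => y; have [n <-] := qsurj y.
  by rewrite gE => /qE.
have [h hE] := Tinj _ _ g f gI.
exists h; rewrite -[x]scale1r -[1 *: x]/(nx 1) -gE hE fE.
by move/pE => [n]; exact: wZ.
Qed.

End RationalsModIntegers.

(** * Arbitrary rings, by coinduction from the integers *)

Section EnoughInjectives.
Variable R : pzRingType.
Implicit Types K M N L P Q V : lmodType R.

Lemma zmod_morphismD (U V : zmodType) (f : U -> V) :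
  zmod_morphism f -> {morph f : x y / x + y}.
Proof.
move=> fB; pose g : {additive U -> V} :=
  HB.pack f (GRing.isZmodMorphism.Build U V f fB).
exact: (raddfD g).
Qed.

(** [C] is the group of additive maps from R to T, on which a acts by precomposition with right
    multiplication by a. *)
Lemma coinduced_exists (T : lmodType int) :
  exists (C : lmodType R) (ev : C -> R -> T),
  [/\ forall c, zmod_morphism (ev c),
      forall a c c' r, ev (a *: c + c') r = ev c (r * a) + ev c' r,
      injective ev
    & forall h, zmod_morphism h -> exists c, ev c = h].
Proof.
pose A := [set h : R -> T | zmod_morphism h].
have hA : is_submodule A.
  split=> [x y|a h h' hh hh' x y]; first exact/esym/subrr.
  by rewrite /GRing.add /= /GRing.scale /= hh hh' scalerBr addrACA -opprD.
have [K [k [kI kE]]] := submodule_exists hA.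
have kA c : zmod_morphism (k c) by apply/kE; exists c.
have ks (a : R) c : exists c', k c' = (fun r => k c (r * a)).
  by apply/kE => x y; rewrite mulrBl kA.
have [s sE] : exists s : R -> K -> K, forall a c r, k (s a c) r = k c (r * a).
  have /choice[s sE] : forall ac : R * K, exists c', k c' = (fun r => k ac.2 (r * ac.1)).
    by case.
  by exists (fun a c => s (a, c)) => a c r; rewrite sE.
have sA a b c : s a (s b c) = s (a * b) c.
  by apply: kI; apply/funext => r; rewrite !sE mulrA.
have s1 : left_id 1 s by move=> c; apply: kI; apply/funext => r; rewrite sE mulr1.
have kD c c' r : k (c + c') r = k c r + k c' r by rewrite linearD.
have sDr : right_distributive s +%R.
  by move=> a c c'; apply: kI; apply/funext => r; rewrite kD !sE kD.
have sDl c : {morph s^~ c : a b / a + b}.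
  by move=> a b; apply: kI; apply/funext => r; rewrite kD !sE mulrDr zmod_morphismD.
pose C : lmodType R := HB.pack (K : Type) (GRing.Zmodule.class K)
  (GRing.Zmodule_isLmodule.Build R K sA s1 sDr sDl).
exists C, k; split=> //.
  by move=> a c c' r; rewrite [LHS]kD; congr (_ + _); exact: sE.
by move=> h hh; apply/kE.
Qed.

(** Coinduction is right adjoint to the forgetful functor: [induce] makes an additive map N -> T
    into a linear map N -> C, and evaluation at 1 goes back. Both properties thus transfer from
    T. *)
Lemma injective_cogenerator : exists C : lmodType R, injective_module C /\
  forall M (x : M), x <> 0 -> exists f : {linear M -> C}, f x <> 0.
Proof.
have [T [Tinj Tcog]] := int_injective_cogenerator.
have [C [ev [evB evL evI evS]]] := coinduced_exists T.
have ev0 r : ev 0 r = 0.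
  by have := evL 1 0 0 r; rewrite scale1r addr0 mulr1 => /eqP;
    rewrite -subr_eq0 opprD addNKr oppr_eq0 => /eqP.
have evD c c' r : ev (c + c') r = ev c r + ev c' r.
  by rewrite -[c]scale1r evL mulr1 scale1r.
have evZ a c r : ev (a *: c) r = ev c (r * a).
  by rewrite -[a *: c]addr0 evL ev0 addr0.
have induce N (h : {linear zmodule N -> T}) :
    exists f : {linear N -> C}, forall n r, ev (f n) r = h (r *: n).
  have /choice[f fE] : forall n : N, exists c, ev c = (fun r => h (r *: n)).
    by move=> n; apply: evS => r s; rewrite scalerBl linearB.
  have fL : linear f.
    move=> a x y; apply: evI; apply/funext => r.
    by rewrite evL !fE scalerDr scalerA linearD.
  by exists (linear_of fL) => n r; rewrite /= fE.
exists C; split.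
  move=> M N g f gI.
  have gL : linear (g : zmodule M -> zmodule N).
    by apply: zmod_morphism_intL => x y; rewrite linearB.
  have fL : linear (fun m : zmodule M => ev (f m) 1).
    apply: zmod_morphism_intL => x y.
    by rewrite linearB -[in RHS](subrK (f y) (f x)) [in RHS]evD addrK.
  have [H HE] := Tinj _ _ (linear_of gL) (linear_of fL) gI.
  have [h hE] := induce _ H.
  exists h => x; apply: evI; apply/funext => r.
  rewrite hE -linearZ; have /= -> := HE (r *: x).
  by rewrite linearZ evZ mul1r.
move=> M x x0; have [h hx] := Tcog (zmodule M) x x0.
have [f fE] := induce _ h.
by exists f => fx; apply: hx; rewrite -[x]scale1r -fE fx ev0.
Qed.

Lemma product_injective (X : Type) Q : injective_module Q ->
  injective_module (X -> Q).
Proof.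
move=> hQ M N g f gI.
have /choice[h hE] : forall x : X, exists h : {linear N -> Q},
    forall m, h (g m) = f m x.
  move=> x; have fL : linear (fun m => f m x) by move=> a m m'; rewrite linearP.
  have [h hE] := hQ _ _ g (linear_of fL) gI; by exists h.
have hL : linear (fun n => h ^~ n : X -> Q).
  by move=> a n n'; apply/funext => x; rewrite linearP.
by exists (linear_of hL) => m; apply/funext => x; exact: hE.
Qed.

(** M embeds in the product of copies of the cogenerator indexed by all maps from M to it. *)
Lemma enough_injectives M : exists (Q : lmodType R) (j : {linear M -> Q}),
  injective_module Q /\ injective j.
Proof.
have [C [Cinj Ccog]] := injective_cogenerator.
have jL : linear (fun m (f : {linear M -> C}) => f m).
  by move=> a m m'; apply/funext => f; rewrite linearP.
exists _, (linear_of jL); split; first exact: product_injective.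
apply: linear_inj => x jx; apply: contrapT => /Ccog[f]; apply.
exact: (congr1 (@^~ f) jx).
Qed.

End EnoughInjectives.

(** * Modules over a left hereditary ring *)

Section Hereditary.
Variable R : pzRingType.
Hypothesis hR : left_hereditary R.
Implicit Types K M N L P Q V : lmodType R.

Lemma projective_retract K P (i : {linear K -> P}) (r : {linear P -> K}) :
  projective P -> (forall x, r (i x) = x) -> projective K.
Proof.
move=> hP ri M N g f gsurj; have [h hE] := hP _ _ g (f \o r) gsurj.
by exists (h \o i) => x /=; rewrite hE /= ri.
Qed.

Lemma left_ideal_projective K (k : {linear K -> R^o}) :
  injective k -> projective K.
Proof.
move=> kI.
have [S hS] := submodClosed_exists (image_is_submodule k (@setT_is_submodule _ K)).
have [i iE] : exists i : {linear K -> submodule_type S}, forall x, \val (i x) = k x.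
  apply: (lift_through_inj (k := \val)) => [|x]; first exact: val_inj.
  have kxS : k x \in S by apply/hS; exists x.
  by exists (SubmoduleElt kxS).
have [r rE] : exists r : {linear submodule_type S -> K}, forall x, k (r x) = \val x.
  apply: (lift_through_inj (f := \val)) => // x.
  by have /hS[y _ yx] := valP x; exists y.
have ri x : r (i x) = x by apply: kI; rewrite rE iE.
exact: projective_retract (@hR S) ri.
Qed.

(** By Baer's criterion: a map from a left ideal to Q' lifts to Q, the ideal being projective, and
    the lift extends to R. *)
Lemma quotient_injective Q Q' (p : {linear Q -> Q'}) :
  injective_module Q -> (forall y, exists x, p x = y) -> injective_module Q'.
Proof.
move=> hQ psurj; apply: baer_injective => K k f kI.
have hK : projective K by exact: left_ideal_projective kI.
have [f' f'E] := hK _ _ p f psurj.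
have [h hE] := hQ _ _ k f' kI.
exists (p (h 1)) => x; rewrite -f'E -hE -!linearZ; congr (p (h _)).
exact/esym/mulr1.
Qed.

(* Embed M into an injective Q: as Q / ker g is again injective, f extends to a
   map from P to Q / ker g, which lifts to Q; its restriction to K lands in M. *)
Lemma projective_sub K P (j : {linear K -> P}) :
  projective P -> injective j -> projective K.
Proof.
move=> hP jI M N g f gsurj.
have [Q [m [hQ mI]]] := enough_injectives M.
have hker := image_is_submodule m (preimage_is_submodule g (@zero_is_submodule _ N)).
have [Q' [p [psurj pE]]] := quotient_exists hker.
have [n nE] : exists n : {linear N -> Q'}, forall x, n (g x) = p (m x).
  by apply: (factor_surj (f := p \o m)) => // x gx; apply/pE; exists x.
have hQ' : injective_module Q' by exact: quotient_injective psurj.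
have [f' f'E] := hQ' _ _ j (n \o f) jI.
have [h hE] := hP _ _ p f' psurj.
have [h' h'E] : exists h' : {linear K -> M}, forall x, m (h' x) = h (j x).
  apply: (lift_through_inj (f := h \o j)) => // x /=.
  have [y yE] := gsurj (f x).
  have : p (h (j x) - m y) = 0 by rewrite linearB hE f'E /= -yE nE subrr.
  move/pE => [z _ zE]; exists (z + y); rewrite linearD zE.
  exact: subrK.
exists h' => x; have [y yE] := gsurj (f x).
have : p (m (h' x - y)) = 0.
  by rewrite !linearB h'E hE f'E /= -yE nE subrr.
move/pE => [z gz /mI zE].
by rewrite -yE; apply/subr0_eq; rewrite -linearB -zE.
Qed.

(** The image of t is projective as a submodule of P, so M maps onto it by a split surjection [a]
    with section [b], and x - b (a x) is the component of x in Ker t. *)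
Lemma projective_image_split M P (t : {linear M -> P}) : projective P ->
  exists P' (a : {linear M -> P'}) (b : {linear P' -> M}),
  [/\ projective P', forall x, t (b (a x)) = t x
    & forall x, t x = 0 -> a x = 0].
Proof.
move=> hP.
have [K [k [kI kE]]] := submodule_exists (image_is_submodule t (@setT_is_submodule _ M)).
have [a aE] : exists a : {linear M -> K}, forall x, k (a x) = t x.
  by apply: lift_through_inj => // x; apply/kE; exists x.
have hK := projective_sub hP kI.
have asurj y : exists x, a x = y.
  have /kE[x _ xE] : exists y', k y' = k y by exists y.
  by exists x; apply: kI; rewrite aE.
have [b bE] := hK _ _ a idfun asurj.
exists K, a, b; split=> // [x|x tx0].
  by rewrite -aE bE /= aE.
by apply: (linear_inj0 kI); rewrite aE.
Qed.

(** Ker t has a complement in M; it meets A trivially, so it is zero. Hence maps into projectives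
    are determined by their values on an essential subset. *)
Lemma vanish_on_essential M P (t : {linear M -> P}) (A : set M) : projective P ->
  essential A -> (forall x, A x -> t x = 0) -> forall x, t x = 0.
Proof.
move=> hP eA tA x.
have [P' [a [b [_ tba aker]]]] := projective_image_split t hP.
have D := image_is_submodule (b \o a) (@setT_is_submodule _ M).
have ba0 : b (a x) = 0.
  apply: (eA _ D); last by exists x.
  by move=> _ [y _ <-] /= /tA; rewrite tba => /aker ->; rewrite linear0.
by rewrite -tba ba0 linear0.
Qed.

(** Splitting off the image of f embeds M in a product of two projectives. *)
Lemma projective_extension M K P (f : {linear M -> P}) (k : {linear K -> M}) :
  projective P -> projective K -> injective k ->
  (forall x, f x = 0 -> exists y, k y = x) -> projective M.
Proof.
move=> hP hK kI fker.
have [P' [a [b [hP' fba aker]]]] := projective_image_split f hP.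
have [l lE] : exists l : {linear M -> K}, forall x, k (l x) = x - b (a x).
  apply: (lift_through_inj (f := idfun \- (b \o a))) => // x /=.
  by apply: fker; rewrite linearB fba subrr.
apply: (projective_sub (j := linear_of (pair_linear a l))).
  exact: projective_prod hP' hK.
apply: linear_inj => x [ax lx].
by have := lE x; rewrite lx ax (linear0 k) (linear0 b) subr0.
Qed.

(** Dividing an injective module containing M by a maximal complement of M keeps it injective over a
    hereditary ring, and maximality makes M essential in the quotient. *)
Lemma injective_envelope_exists M : exists (E : lmodType R) (i : {linear M -> E}),
  injective_envelope i.
Proof.
have [Q [j [hQ jI]]] := enough_injectives M.
have hj := image_is_submodule j (@setT_is_submodule _ M).
have [C [hC jC Cmax]] := maximal_complement hj.
have [E [p [psurj pE]]] := quotient_exists hC.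
exists E, (p \o j); split; first exact: quotient_injective psurj.
split.
  apply: linear_inj => x /pE jx; apply: (linear_inj0 jI).
  by apply: jC => //; exists x.
move=> S hS y; have [x <-] := psurj y => xS.
apply/pE; apply: (Cmax (p @^-1` [set z | z \in S])) => //.
- exact/preimage_is_submodule/submodClosed_is_submodule.
- by move=> z /pE /= ->; exact: rpred0.
- by move=> _ [z _ <-] /hS; rewrite /= => /pE jz; apply: jC => //; exists z.
Qed.

End Hereditary.

(** * Independent sets *)

Section LinearSpan.
Variable R : pzRingType.
Implicit Types K M N L P Q V : lmodType R.

Definition linear_span V (T : set V) : set V :=
  [set x | forall A, is_submodule A -> T `<=` A -> A x].

Lemma linear_span_is_submodule V (T : set V) : is_submodule (linear_span T).
Proof.
split=> [A hA _|a x y Tx Ty A hA TA]; first exact: submodule0.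
by apply: hA.2; [exact: Tx|exact: Ty].
Qed.

Lemma linear_span0 V (T : set V) : linear_span T 0.
Proof. by move=> A hA _; exact: submodule0. Qed.

Lemma sub_linear_span V (T : set V) : T `<=` linear_span T.
Proof. by move=> x Tx A _; exact. Qed.

Lemma linear_span_sub V (T A : set V) : is_submodule A -> T `<=` A -> linear_span T `<=` A.
Proof. by move=> hA TA x; exact. Qed.

Lemma linear_spanS V (T T' : set V) : T `<=` T' -> linear_span T `<=` linear_span T'.
Proof.
move=> TT'; apply: linear_span_sub; first exact: linear_span_is_submodule.
by move=> x /TT'; exact: sub_linear_span.
Qed.

Definition line V (b : V) : set V := [set x | exists r : R, x = r *: b].

Lemma line_is_submodule V (b : V) : is_submodule (line b).
Proof.
split; first by exists 0; rewrite scale0r.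
by move=> a _ _ [r ->] [s ->]; exists (a * r + s); rewrite scalerDl scalerA.
Qed.

Lemma line_self V (b : V) : line b b.
Proof. by exists 1; rewrite scale1r. Qed.

(** This says that the sum of the nonzero cyclic submodules R b is direct; elements of S may have
    nonzero annihilators. *)
Definition independent V (S : set V) := forall b, S b ->
  b <> 0 /\ forall x, line b x -> linear_span (S `\ b) x -> x = 0.

(** A relation in the span of the union of a chain already holds in the span of one member, which
    can be taken to contain b. *)
Lemma independent_bigcup V (F : set (set V)) : total_on F subset ->
  (forall S, F S -> independent S) -> independent (\bigcup_(S in F) S).
Proof.
move=> Ftot Find b [S0 FS0 S0b]; have [b0 _] := Find _ FS0 _ S0b.
split=> // x bx.
pose A := [set y | exists S, [/\ F S, S b & linear_span (S `\ b) y]].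
have hA : is_submodule A.
  split; first by exists S0; split=> //; exact: linear_span0.
  move=> a y z [S [FS Sb Sy]] [S' [FS' S'b S'z]].
  have [SS'|S'S] := Ftot _ _ FS FS'.
    exists S'; split=> //; apply: (linear_span_is_submodule (S' `\ b)).2 => //.
    by apply: linear_spanS Sy => w [/SS' S'w wb]; split.
  exists S; split=> //; apply: (linear_span_is_submodule (S `\ b)).2 => //.
  by apply: linear_spanS S'z => w [/S'S Sw wb]; split.
move=> /(_ A hA)[|S [FS Sb Sx]]; last exact: (Find _ FS _ Sb).2.
move=> y [[S FS Sy] yb]; have [SS0|S0S] := Ftot _ _ FS FS0.
  by exists S0; split=> //; apply: sub_linear_span; split=> //; exact: SS0.
by exists S; split=> //; [exact: S0S|apply: sub_linear_span; split].
Qed.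

(** If x in R b is a sum of u in the span of the other elements of S and w in R d, then w = x - u
    lies in the span of S and vanishes. *)
Lemma independent_setU1 V (S : set V) d : independent S -> d <> 0 ->
  (forall x, line d x -> linear_span S x -> x = 0) -> independent (d |` S).
Proof.
move=> indS d0 dS b [->|Sb].
  split=> // x dx Sx; apply: dS => //.
  by apply: linear_spanS Sx => y [[->|//]]; move/(_ erefl).
have [b0 bS] := indS _ Sb; split=> // x bx xS.
have : addS (linear_span (S `\ b)) (line d) x.
  apply: linear_span_sub xS.
    by apply: addS_is_submodule; [exact: linear_span_is_submodule|exact: line_is_submodule].
  move=> y [[->|Sy] yb].
    exists 0, d; split; [exact: linear_span0|exact: line_self|].
    by rewrite add0r.
  exists y, 0; split; [by apply: sub_linear_span; split| |by rewrite addr0].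
  by exists 0; rewrite scale0r.
move=> [u [w [Su dw xuw]]].
have w0 : w = 0.
  apply: dS => //; have -> : w = x - u by rewrite xuw addrC addKr.
  apply: (submoduleB (linear_span_is_submodule S)).
    have [r ->] := bx; apply: (submoduleZ (linear_span_is_submodule S)).
    exact: sub_linear_span.
  by apply: linear_spanS Su => y [].
by apply: bS => //; rewrite xuw w0 addr0.
Qed.

Lemma maximal_independent V : exists S : set V, independent S /\ essential (linear_span S).
Proof.
have [F Find Ftot|S [indS Smax]] := @Zorn_bigcup V [set S | independent S].
  exact: independent_bigcup.
exists S; split=> // D hD DS d Dd; apply: contrapT => d0.
have Sd : ~ S d by move=> Sd; apply/d0/DS => //; exact: sub_linear_span.
apply: (Smax (d |` S)).
  by split=> [x Sx|]; [right|move=> /(_ d (or_introl erefl))].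
apply: independent_setU1 => // x [r ->]; apply: DS.
exact: (submoduleZ hD).
Qed.

End LinearSpan.

(** * Hereditary rings with a projective injective envelope *)

Section ProjectiveEnvelope.
Variables (R : pzRingType) (hR : left_hereditary R).
Variables (E : lmodType R) (i : {linear R^o -> E}).
Hypotheses (hi : injective_envelope i) (hE : projective E).
Implicit Types K M N L P Q V : lmodType R.

Let injE : injective_module E := hi.1.

Let i_inj : injective i := hi.2.1.

Lemma regular_projective : projective (R^o : lmodType R).
Proof. by apply: (left_ideal_projective hR (k := idfun)) => x y. Qed.

Lemma envelope_essential : essential (range i).
Proof.
move=> D hD Di x Dx.
have [S hS] := submodClosed_exists hD.
apply: (hi.2.2 S) => [r /hS Dr|]; last exact/hS.
by apply: Di => //; exists r.
Qed.

(** Each [t x] is determined by its value at [i 1], since R is essential in E and the target is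
    projective. *)
Lemma scalar_family_finite (X : Type) (t : X -> {linear E -> R^o}) :
  (forall y, finite_set [set x | t x y <> 0]) ->
  finite_set [set x | exists y, t x y <> 0].
Proof.
move=> /(_ (i 1)); apply: sub_finite_set => x [y ty] ti; apply: ty.
apply: (vanish_on_essential hR regular_projective envelope_essential) => _ [r _ <-].
have -> : i r = (r : R) *: i 1 by rewrite -linearZ; congr (i _); exact/esym/mulr1.
by rewrite linearZ ti; exact: mulr0.
Qed.

(** The double annihilator of T with respect to the endomorphisms of E. *)
Definition closure (T : set E) : set E := [set x | forall g : {linear E -> E},
  (forall y, T y -> g y = 0) -> g x = 0].

Lemma closure_is_submodule T : is_submodule (closure T).
Proof.
split=> [g _|a x y Tx Ty g gT]; first exact: linear0.
by rewrite linearP Tx // Ty // scaler0 addr0.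
Qed.

Lemma sub_closure T : T `<=` closure T.
Proof. by move=> x Tx g; exact. Qed.

Lemma closureS T T' : T `<=` T' -> closure T `<=` closure T'.
Proof. by move=> TT' x Tx g gT'; apply: Tx => y /TT'; exact: gT'. Qed.

(** Project along a maximal complement of the closure. The values of e stay in the closure because g
    e vanishes on an essential submodule, hence everywhere, as soon as g vanishes on T. *)
Lemma closure_projection T : exists e : {linear E -> E},
  (forall x, closure T x -> e x = x) /\ forall x, closure T (e x).
Proof.
have hT := closure_is_submodule T.
have [C [hC TC eTC]] := complement_essential hT.
have [e [eT eC]] := injective_projection injE hT hC TC.
exists e; split=> // x g gT.
apply: (vanish_on_essential hR (t := g \o e) hE eTC) => _ [y [z [Ty Cz ->]]] /=.
by rewrite linearD eT // eC // addr0; exact: Ty.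
Qed.

(* The sets with finite columns form an ideal of subsets of nat * nat that
   contains the finite sets and is not countably generated. *)
Definition finite_columns (A : set (nat * nat)) :=
  forall n, finite_set [set m | A (n, m)].

(** The maps [g] ensure that v b lies in the closure F A only when b is in A, so inclusions between
    closures reflect inclusions between index sets. *)
Lemma no_biorthogonal_family (v : nat * nat -> E)
    (g : nat * nat -> {linear E -> E}) :
  (forall b, g b (v b) <> 0) -> (forall a b, a <> b -> g b (v a) = 0) -> False.
Proof.
move=> gv0 gv.
pose F A := closure (v @` A).
have FS A B : A `<=` B -> F A `<=` F B by move=> AB; apply/closureS/image_subset.
pose J := [set x | exists2 A, finite_columns A & F A x].
have hJ : is_submodule J.
  split; first by exists set0; [move=> n; exact: finite_set0|
    apply: (submodule0 (closure_is_submodule _))].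
  move=> a x y [A fA Ax] [B fB By]; exists (A `|` B).
    by move=> n; rewrite (_ : [set m | _] = [set m | A (n, m)] `|` [set m | B (n, m)])
      // finite_setU.
  by apply: (closure_is_submodule _).2; [apply: FS Ax|apply: FS By] => ? ?; [left|right].
have [K [k [kI kE]]] := submodule_exists hJ.
have hK := projective_sub hR hE kI.
(* Being projective, K is a summand of the free module on its own elements, by a section [s] of the
   canonical map [H]. *)
have [Q [c [u [[cfin cI cu Qgen _] Qsum]]]] := direct_sum_exists K (R^o : lmodType R).
have [H HE] : exists H : {linear Q -> K}, forall x r, H (u x r) = (r : R) *: x.
  have hL (x : K) : linear (fun r : R^o => (r : R) *: x).
    by move=> a r s; rewrite scalerDl scalerA.
  exact: (Qsum _ (fun x => linear_of (hL x))).
have [s sE] : exists s : {linear K -> Q}, forall x, H (s x) = x.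
  by apply: (hK _ _ H idfun) => x; exists (u x 1); rewrite HE scale1r.
have /choice[w wE] : forall b, exists x, k x = v b.
  move=> b; apply/kE; exists [set b]; last first.
    by apply: sub_closure; exists b.
  move=> n; apply: (sub_finite_set _ (finite_set1 b.2)) => m /= <-.
  by [].
pose X0 := [set x | exists b, c x (s (w b)) <> 0].
have X0count : countable X0.
  have : countable (\bigcup_(b in [set: nat * nat]) [set x | c x (s (w b)) <> 0]).
    apply: bigcup_countable => [|b _]; first exact: countableP.
    exact/finite_set_countable/cfin.
  by apply: sub_countable; apply: subset_card_le => x [b cb]; exists b.
(* A coordinate of s that vanishes on all v b extends to an endomorphism of E that kills every
   closure F A, hence all of J. So only the countably many coordinates in [X0] occur. *)
have X0P x y : c x (s y) <> 0 -> X0 x.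
  move=> cxy; apply: contrapT => nX0x; apply: cxy.
  have [G GE] := injE (i \o c x \o s) kI.
  have Gv b : G (v b) = 0.
    rewrite -wE GE /= (_ : c x _ = 0) ?linear0 //.
    by apply: contrapT => cb; apply: nX0x; exists b.
  have [A _ Ay] : J (k y) by apply/kE; exists y.
  apply: (linear_inj0 i_inj); have /= <- := GE y; apply: Ay.
  by move=> _ [b _ <-].
have /choice[A AE] : forall x, exists B, finite_columns B /\ F B (k x).
  move=> x; have [B fB Bx] : J (k x) by apply/kE; exists x.
  by exists B.
have /countable_injP[f fI] := X0count.
have colfin n : finite_set
    [set m | exists x, [/\ X0 x, (f x <= n)%N & A x (n, m)]].
  pose D := X0 `&` [set x | (f x <= n)%N].
  have Dfin : finite_set D.
    rewrite -(eq_finite_set (inj_card_eq (f := f) (A := D) _)).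
      by apply: (sub_finite_set _ (finite_II n.+1)) => _ [x [_ fx] <-].
    by move=> x y /set_mem[Xx _] /set_mem[Xy _]; apply: fI; exact/mem_set.
  have : finite_set (\bigcup_(x in D) [set m | A x (n, m)]).
    by apply: bigcup_finite => // x _; exact: (AE x).1.
  by apply: sub_finite_set => m [x [X0x fx Ax]]; exists x.
(* Diagonal choice: in column n, the point d n avoids the finitely many sets A x with x in [X0]
   numbered at most n by [f]. *)
have /choice[d dE] : forall n, exists m, forall x,
    X0 x -> (f x <= n)%N -> ~ A x (n, m).
  move=> n; have [m mE] : exists m, ~ exists x, [/\ X0 x, (f x <= n)%N & A x (n, m)].
    apply: contrapT => /forallNP h; apply: infinite_nat.
    by apply: (sub_finite_set _ (colfin n)) => m _; exact: contrapT (h m).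
  by exists m => x X0x fx Ax; apply: mE; exists x.
pose B := [set b : nat * nat | b.2 = d b.1].
have fB : finite_columns B.
  by move=> n; apply: (sub_finite_set _ (finite_set1 (d n))).
have [e [eB Be]] := closure_projection (v @` B).
have [e' e'E] : exists e' : {linear E -> K}, forall x, k (e' x) = e x.
  by apply: lift_through_inj => // x; apply/kE; exists B => //; exact: Be.
pose Y := [set x | exists y, c x (s (e' y)) <> 0].
(* The coordinates of s e' form a pointwise finite family on E, so almost all of them are zero. Thus
   F B lies in F U for a finite union [U] of sets A x. *)
have Yfin : finite_set Y.
  apply: (scalar_family_finite (t := fun x => c x \o s \o e')) => y.
  exact: cfin.
pose U := [set b | exists2 x, Y x & A x b].
have FBU y : F B y -> F U y.
  move=> By; have -> : y = k (H (s (e' y))) by rewrite sE e'E eB.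
  have hFU := preimage_is_submodule (k \o H) (closure_is_submodule (v @` U)).
  apply: (Qgen _ _ hFU) => x /=; rewrite HE linearZ.
  have [->|cx] := pselect (c x (s (e' y)) = 0).
    have := submodule0 (closure_is_submodule (v @` U)).
    by rewrite -(scale0r (k x)).
  apply: (submoduleZ (closure_is_submodule _)).
  apply: (FS (A x)); last exact: (AE x).2.
  by move=> b Ab; exists x => //; exists y.
have dU n : U (n, d n).
  apply: contrapT => nU; have vB : F B (v (n, d n)).
    by apply: sub_closure; exists (n, d n).
  apply: (gv0 (n, d n)); apply: (FBU _ vB) => _ [a Ua <-]; apply: gv => ae.
  by apply: nU; rewrite -ae.
(* This n bounds the numbers of all x in [Y], so d n was chosen outside every set making up column n
   of [U]. *)
pose n := \max_(x <- fset_set Y) f x.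
have [x Yx Ax] := dU n.
apply: (dE n x) => //; first by have [y /X0P] := Yx.
by apply: leq_bigmax_seq => //; rewrite in_fset_set // inE.
Qed.

(** An infinite maximal independent set would contain distinct elements indexed by nat * nat.
    Projecting each line along the span of the rest, and extending to E, would make them
    biorthogonal. *)
Lemma finite_essential_subset K (k : {linear K -> E}) : injective k ->
  exists S : set K, finite_set S /\ essential (linear_span S).
Proof.
move=> kI; have [S [indS eS]] := maximal_independent K.
exists S; split=> //; apply: contrapT => /infiniteP.
pose pK : pointedType := HB.pack (K : Type) (Choice.class K) (isPointed.Build K 0).
move=> /(@pcard_leP _ pK)/injfunPex[u uS u_inj].
pose b (a : nat * nat) : K := u (choice.pickle a).
have Sb a : S (b a) by exact: uS.
have b_inj : injective b.
  move=> a a' e; apply: (pcan_inj choice.pickleK); apply: u_inj => //; exact: mem_set.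
have /choice[g gE] : forall a, exists g : {linear E -> E},
    (forall x, (k @` line (b a)) x -> g x = x) /\
    (forall x, (k @` linear_span (S `\ b a)) x -> g x = 0).
  move=> a; apply: (injective_projection injE).
  - exact/image_is_submodule/line_is_submodule.
  - exact/image_is_submodule/linear_span_is_submodule.
  - move=> _ [x bx <-] [y Sy /kI yx]; rewrite yx in Sy.
    by have -> : x = 0; [exact: (indS _ (Sb a)).2|exact: linear0].
apply: (no_biorthogonal_family (v := k \o b) (g := g)) => [a|a a' aa'] /=.
  rewrite (gE a).1; last by exists (b a) => //; exact: line_self.
  by move/(linear_inj0 kI); exact: (indS _ (Sb a)).1.
apply: (gE a').2; exists (b a) => //; apply: sub_linear_span; split=> //.
by move/b_inj.
Qed.

(** For Baer's criterion, a left ideal has a finite subset with essential span. A map into the sum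
    involves finitely many coordinates there, and the other coordinates, vanishing on that span, are
    zero. *)
Lemma direct_sum_injective_projective (X : choiceType) :
  exists (Q : lmodType R) (c : X -> {linear Q -> E}),
  [/\ injective_module Q, projective Q & forall M (f : X -> {linear M -> E}),
        (forall m, finite_set [set x | f x m <> 0]) ->
        exists g : {linear M -> Q}, forall x m, c x (g m) = f x m].
Proof.
have [Q [c [u [[cfin cI cu Qgen Qlift] Qsum]]]] := direct_sum_exists X E.
exists Q, c; split=> //.
  apply: baer_injective => K k f kI.
  have [S [Sfin eS]] := finite_essential_subset (k := i \o k) (inj_comp i_inj kI).
  pose Y := [set x | exists y, c x (f y) <> 0].
  have Yfin : finite_set Y.
    have : finite_set (\bigcup_(y in S) [set x | c x (f y) <> 0]).
      by apply: bigcup_finite => // y _; exact: cfin.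
    apply: sub_finite_set => x [y cy]; apply: contrapT => nS; apply: cy.
    apply: (vanish_on_essential hR (t := c x \o f) hE eS) => z Sz /=.
    have := preimage_is_submodule (c x \o f) (@zero_is_submodule _ E).
    move=> /Sz; apply=> w Sw /=; apply: contrapT => cw.
    by apply: nS; exists w.
  (* Extending by zero outside the finite set [Y] keeps the family pointwise finite, so that it
     assembles into a map to [Q]. *)
  have /choice[h hX] : forall x, exists h : {linear R^o -> E},
      (forall y, h (k y) = c x (f y)) /\ (~ Y x -> forall r, h r = 0).
    move=> x; have [Yx|nYx] := pselect (Y x).
      by have [h hE'] := injE (c x \o f) kI; exists h.
    exists \0; split=> // y; apply: esym; apply: contrapT => cy.
    by apply: nYx; exists y.
  have [r|q qE] := Qlift _ h.
    apply: (sub_finite_set _ Yfin) => x hx; apply: contrapT => nYx.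
    by apply: hx; exact: (hX x).2.
  exists (q 1) => y; apply: cI => x.
  rewrite -(hX x).1 linearZ qE -linearZ; congr (h x _).
  exact/esym/mulr1.
move=> M N g f gsurj.
have /choice[h hx] : forall x, exists h : {linear E -> M}, forall y, g (h y) = f (u x y).
  by move=> x; have [h hh] := hE (f \o u x) gsurj; exists h.
have [h' h'E] := Qsum _ h.
exists h' => q; apply/eqP; rewrite -subr_eq0; apply/eqP.
have hA := preimage_is_submodule ((g \o h') \- f) (@zero_is_submodule _ N).
by apply: (Qgen _ _ hA) => x /=; rewrite h'E hx subrr.
Qed.

(** P is a summand of a free module, which embeds coordinatewise in a direct sum of copies of E. *)
Lemma projective_embedding P : projective P ->
  exists (Q : lmodType R) (w : {linear P -> Q}),
  [/\ injective_module Q, projective Q & injective w].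
Proof.
move=> hP.
have [L [c [u [[cfin cI cu Lgen _] Lsum]]]] := direct_sum_exists P (R^o : lmodType R).
have [H HE] : exists H : {linear L -> P}, forall x r, H (u x r) = (r : R) *: x.
  have hL (x : P) : linear (fun r : R^o => (r : R) *: x).
    by move=> a r s; rewrite scalerDl scalerA.
  exact: (Lsum _ (fun x => linear_of (hL x))).
have [s sE] : exists s : {linear P -> L}, forall x, H (s x) = x.
  by apply: (hP _ _ H idfun) => x; exists (u x 1); rewrite HE scale1r.
have [Q [d [Qinj Qproj Qlift]]] := direct_sum_injective_projective P.
have [p|w wE] := Qlift _ (fun x => i \o c x \o s).
  apply: (sub_finite_set _ (cfin (s p))) => x /= ix cx; apply: ix.
  by rewrite cx linear0.
exists Q, w; split=> //; apply: linear_inj => p wp.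
have sp : s p = 0.
  apply: cI => x; rewrite linear0; apply: (linear_inj0 i_inj).
  by have /= <- := wE x p; rewrite wp linear0.
by rewrite -[p]sE sp linear0.
Qed.

End ProjectiveEnvelope.

(** * Normality of the stable category *)

Section StableMonomorphisms.
Variables (R : pzRingType) (hR : left_hereditary R).
Implicit Types K M N L P Q V : lmodType R.

Lemma stable_class0 M N (f : {linear M -> N}) :
  stable_class f = stable_zero M N <-> factors_through_projective f.
Proof.
rewrite /stable_zero stable_classP.
by split; apply: factors_ext => x /=; rewrite subr0.
Qed.

(** Replacing x by x - b (a x), a change that is stably zero, turns a stably zero f into one that
    vanishes exactly. *)
Lemma factors_split M N (f : {linear M -> N}) : factors_through_projective f ->
  exists P (a : {linear M -> P}) (b : {linear P -> M}),
  projective P /\ forall x, f (b (a x)) = f x.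
Proof.
move=> [P [u [v [hP fE]]]].
have [P' [a [b [hP' uba _]]]] := projective_image_split hR u hP.
by exists P', a, b; split=> // x; rewrite !fE uba.
Qed.

(** If f (u' - v') is stably zero, then u' - v', after a stably trivial correction, lands in Ker f
    and so factors through K. *)
Lemma stable_mono_of_projective_kernel M N K (f : {linear M -> N})
    (k : {linear K -> M}) : projective K -> injective k ->
  (forall x, f x = 0 -> exists y, k y = x) ->
  @monomorphism (stable_category R) M N (stable_class f).
Proof.
move=> hK kI fker X u v.
rewrite -(stable_reprK u) -(stable_reprK v) /= !stable_comp_class.
set u' := stable_repr u; set v' := stable_repr v.
move/stable_classP => h; apply/stable_classP.
have [P [a [b [hP ba]]]] : exists P (a : {linear X -> P}) (b : {linear P -> X}),
    projective P /\ forall x, f (u' (b (a x)) - v' (b (a x))) = f (u' x - v' x).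
  have h' : factors_through_projective (f \o (u' \- v')).
    by apply: factors_ext h => x /=; rewrite linearB.
  exact: (factors_split h').
have [l lE] : exists l : {linear X -> K}, forall x,
    k (l x) = u' x - v' x - (u' (b (a x)) - v' (b (a x))).
  apply: (lift_through_inj (f := (u' \- v') \- ((u' \- v') \o (b \o a)))) => // x /=.
  by apply: fker; rewrite linearB ba subrr.
apply: (factors_ext (f := (k \o l) \+ ((u' \- v') \o (b \o a)))).
  by move=> x /=; rewrite lE subrK.
apply: factors_add; first by exists K, l, k.
by exists P, a, ((u' \- v') \o b).
Qed.

(** Cancelling the stable mono shows k to be stably zero; since k is injective, so is its first
    factor, which embeds K in a projective. *)
Lemma stable_mono_kernel_projective M N K (f : {linear M -> N})
    (k : {linear K -> M}) : injective k -> (forall y, f (k y) = 0) ->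
  @monomorphism (stable_category R) M N (stable_class f) -> projective K.
Proof.
move=> kI fk /(_ K (stable_class k) (stable_class \0)) /=.
rewrite !stable_comp_class => mono.
have /stable_class0 [P [u [v [hP kE]]]] : stable_class k = stable_zero K M.
  by apply: mono; apply: stable_class_ext => x /=; rewrite fk linear0.
apply: (projective_sub hR hP (j := u)); apply: linear_inj => x ux.
by apply: (linear_inj0 kI); rewrite kE ux linear0.
Qed.

(* The inclusion of Ker g is stably p u' for some u'; where it equals p u', it
   identifies a submodule of Ker g with one of E that meets R trivially and so
   vanishes.  Thus Ker g is projective, and as g p is stably zero, E is built
   from projectives. *)
Lemma normal_envelope_projective (E Q : lmodType R) (i : {linear R^o -> E})
    (p : {linear E -> Q}) : essential_mono i ->
  (forall x, p x = 0 <-> exists r, i r = x) ->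
  @normal_mono (stable_category R) E Q (stable_class p) -> projective E.
Proof.
move=> [iI iess] pE [D [g [gp gker]]].
have hR1 : projective (R^o : lmodType R) := regular_projective hR.
move: gp gker; rewrite -(stable_reprK g); set g' := stable_repr g.
rewrite /= stable_comp_class => /stable_class0 gp gker.
have [K [k [kI kE]]] := submodule_exists (preimage_is_submodule g' (@zero_is_submodule _ _)).
have hK : projective K.
  have [|u [uk _]] := gker K (stable_class k).
    rewrite stable_comp_class; apply: stable_class_ext => y /=.
    by apply/kE; exists y.
  move: uk; rewrite -(stable_reprK u) stable_comp_class; set u' := stable_repr u.
  move/stable_classP => [P [t [w [hP puk]]]].
  apply: (projective_sub hR hP (j := t)); apply: linear_inj => y ty.
  have pu z : t z = 0 -> p (u' z) = k z.
    by move=> tz; apply/subr0_eq; have /= := puk z; rewrite tz linear0.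
  have [S hS] := submodClosed_exists
    (image_is_submodule u' (preimage_is_submodule t (@zero_is_submodule _ P))).
  have uy : u' y = 0.
    apply: (iess S); last by apply/hS; exists y.
    move=> r /hS[z tz uz]; rewrite -uz.
    have kz : k z = 0 by rewrite -pu // uz; apply/pE; exists r.
    by rewrite (linear_inj0 kI kz) linear0.
  by apply: (linear_inj0 kI); rewrite -pu // uy linear0.
have [P [a [b [hP gpba]]]] := factors_split (f := g' \o p) gp.
(* The corrected map lands in Ker g'; elements of E killed by both [a] and [l] are killed by p,
   hence lie in R. *)
have [l lE] : exists l : {linear E -> K}, forall x, k (l x) = p (x - b (a x)).
  apply: (lift_through_inj (f := p \o (idfun \- (b \o a)))) => // x /=.
  by apply/kE; rewrite /= !linearB; apply/eqP; rewrite subr_eq0; apply/eqP/esym/gpba.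
apply: (projective_extension hR (f := linear_of (pair_linear a l)) (k := i)) => //.
  exact: projective_prod hP hK.
move=> x [ax lx]; apply/pE.
by have := lE x; rewrite lx ax (linear0 k) (linear0 b) subr0.
Qed.

(* Extending the embedding of Ker f into a projective injective module to all
   of M replaces f, stably, by an honest monomorphism M -> N * I; it is then
   the kernel of the cokernel of that map. *)
Lemma stable_mono_normal (E : lmodType R) (i : {linear R^o -> E}) :
    injective_envelope i -> projective E ->
  normal_category (stable_category R).
Proof.
move=> hi hE M N f0; rewrite -(stable_reprK f0); set f := stable_repr f0 => mono.
have [K [k [kI kE]]] := submodule_exists (preimage_is_submodule f (@zero_is_submodule _ _)).
have hK : projective K.
  by apply: (stable_mono_kernel_projective kI _ mono) => y; apply/kE; exists y.
have [I [w [Iinj Iproj wI]]] := projective_embedding hR hi hE hK.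
have [e eE] := Iinj _ _ k w kI.
pose F := linear_of (pair_linear f e).
have FI : injective F.
  apply: linear_inj => x [fx ex].
  have [y yx] : exists y, k y = x by apply/kE.
  have y0 : y = 0 by apply: (linear_inj0 wI); rewrite -eE yx.
  by rewrite -yx y0 linear0.
have [D [q [_ qE]]] := quotient_exists (image_is_submodule F (@setT_is_submodule _ M)).
have inlL : linear (fun x : N => (x, 0) : (N * I)%type).
  by move=> a x y; congr pair; rewrite /= scaler0 addr0.
have inrL : linear (fun x : I => (0, x) : (N * I)%type).
  by move=> a x y; congr pair; rewrite /= scaler0 addr0.
pose g := q \o linear_of inlL.
exists D, (stable_class g); split.
  rewrite /= stable_comp_class; apply/stable_class0.
  (* As q kills (f x, e x), the composite g f sends x to - q (0, e x), which passes through the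
     projective [I]. *)
  exists I, e, (\- (q \o linear_of inrL)); split=> // x /=.
  apply/eqP; rewrite -addr_eq0 -linearD; apply/eqP/qE; exists x => //.
  by congr pair; rewrite /= ?addr0 ?add0r.
move=> X h; rewrite -(stable_reprK h); set h' := stable_repr h.
rewrite /= stable_comp_class => /stable_class0 /(factors_split (f := g \o h')).
move=> [P [a [b [hP ghba]]]].
(* After the stable correction by b a, the map g h' vanishes exactly, so the values (h' (x - b (a
   x)), 0) lie in the image of [F]. *)
have [z zE] : exists z : {linear X -> M},
    forall x, F (z x) = (h' (x - b (a x)), 0).
  apply: (lift_through_inj
    (f := linear_of inlL \o (h' \o (idfun \- (b \o a))))) => // x.
  have /qE[y _ yE] : q (h' (x - b (a x)), 0) = 0; last by exists y.
  have := ghba x; rewrite /= => e'.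
  have -> : (h' (x - b (a x)), 0) = (h' x, 0) - (h' (b (a x)), 0) :> (N * I)%type.
    by congr pair; rewrite /= ?linearB ?subr0.
  by rewrite linearB -e' subrr.
have fz : stable_comp (stable_class f) (stable_class z) = stable_class h'.
  rewrite stable_comp_class; apply/stable_classP.
  exists P, a, (\- (h' \o b)); split=> // x /=.
  have [-> _] := zE x; rewrite linearB.
  by rewrite addrAC subrr add0r.
exists (stable_class z); split=> // v vh.
by apply: mono; rewrite /= fz vh.
Qed.

End StableMonomorphisms.

Theorem theorem7p4 (R : pzRingType) (hR : left_hereditary R) :
  normal_category (stable_category R) <->
  exists (E : lmodType R) (i : {linear R^o -> E}),
    injective_envelope i /\ projective E.
Proof.
split=> [normal|[E [i [hi hE]]]]; last exact: (stable_mono_normal hR hi hE).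
have [E [i hi]] := injective_envelope_exists hR (R^o : lmodType R).
exists E, i; split=> //.
have [Q [p [_ pE]]] := quotient_exists (image_is_submodule i (@setT_is_submodule _ R^o)).
have pE' x : p x = 0 <-> exists r, i r = x.
  by rewrite pE; split=> [[r _ <-]|[r <-]]; exists r.
apply: (normal_envelope_projective hR hi.2 pE'); apply: normal.
apply: (stable_mono_of_projective_kernel hR (regular_projective hR) hi.2.1).
by move=> x /pE'.
Qed.
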